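(* Let $\mathbb F$ be a field with $\operatorname{char}\mathbb F\neq2$ and let $n\ge1$. The pair of linear maps $f=(f^-,f^+)$ given by $$f^\sigma\colon H_n(\mathbb F)\to\bigvee^2\mathcal M_{1,n}(\mathbb F),\qquad E_{ij}+E_{ji}\mapsto e_i\vee e_j\qquad(1\le i\le j\le n,\ \sigma=\pm)$$ is an isomorphism of (generalized) Jordan pairs $$\mathcal V^{\mathrm{(III)}}_n\cong\Big(\bigvee^2\mathcal V^{\mathrm{(I)}}_{1,n}\Big)^{[-4]},$$ and it is a similarity of the bilinear forms with multiplier $\tfrac12$: $\langle f^-(x),f^+(y)\rangle=\tfrac12 t(x,y)$ for all $x,y\in H_n(\mathbb F)$. Consequently $(\mathcal V^{\mathrm{(III)}}_n,\tfrac12t)\cong(\bigvee^2\mathcal V^{\mathrm{(I)}}_{1,n},\langle\cdot,\cdot\rangle)^{[-4]}$.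
   Context: All spaces are over $\mathbb F$ (non-super setting). $E_{ij}$ are the matrix units of $\mathcal M_n(\mathbb F)$ and $\{e_i\}_{i=1}^n$ is the canonical basis of $\mathcal M_{1,n}(\mathbb F)$. A generalized Jordan pair is a pair of vector spaces $\mathcal V=(\mathcal V^-,\mathcal V^+)$ with trilinear maps $\{\cdot,\cdot,\cdot\}\colon\mathcal V^\sigma\times\mathcal V^{-\sigma}\times\mathcal V^\sigma\to\mathcal V^\sigma$ ($\sigma=\pm$), $D_{x,y}z=\{x,y,z\}$, such that $[D_{x,y},D_{z,w}]=D_{D_{x,y}z,w}-D_{z,D_{y,x}w}$. It is metric if it is finite-dimensional with a nondegenerate bilinear form $\langle\cdot,\cdot\rangle\colon\mathcal V^-\times\mathcal V^+\to\mathbb F$ (write also $\langle v,f\rangle=\langle f,v\rangle$) with $\langle D_{x,y}z,w\rangle=\langle z,D_{y,x}w\rangle$, $\langle D_{x,y}z,w\rangle=\langle D_{z,w}x,y\rangle$ and $\langle x,D_{y,z}w\rangle=\langle z,D_{w,x}y\rangle$. An isomorphism of pairs is a pair of linear bijections $f^\sigma$ preserving the triple products; an isomorphism of metric pairs also preserves the forms. $\mathcal V^{\mathrm{(I)}}_{p,q}=(\mathcal M_{p,q}(\mathbb F),\mathcal M_{p,q}(\mathbb F))$ with $\{x,y,z\}=xy^{\mathsf T}z+zy^{\mathsf T}x$ and generic trace $t(x,y)=\mathrm{tr}(xy^{\mathsf T})$ (used as bilinear form). $\mathcal V^{\mathrm{(III)}}_n=(H_n(\mathbb F),H_n(\mathbb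 F))$ is the subpair of $\mathcal V^{\mathrm{(I)}}_{n,n}$ of symmetric $n\times n$ matrices, with generic trace $t(x,y)=\sum_ix_{ii}y_{ii}+2\sum_{i<j}x_{ij}y_{ij}$. For a metric generalized Jordan pair $\mathcal V$, let $\nu(f,v)=(D_{f,v},-D_{v,f})\in\mathrm{End}(\mathcal V^-)\times\mathrm{End}(\mathcal V^+)$ for $f\in\mathcal V^-,v\in\mathcal V^+$, and let $L=\mathfrak{instr}(\mathcal V)$ be the Lie algebra spanned by all $\nu(f,v)$; it carries a unique nondegenerate invariant symmetric bilinear form $b$ with $b(x,\nu(f,v))=\langle x\cdot f,v\rangle$. The second symmetric power $\bigvee^2\mathcal V$ is the metric generalized Jordan pair $(\bigvee^2\mathcal V^-,\bigvee^2\mathcal V^+)$ (symmetric squares, $a\vee b=b\vee a$) with form $\langle f_1\vee f_2,v_1\vee v_2\rangle=\langle f_1,v_1\rangle\langle f_2,v_2\rangle+\langle f_1,v_2\rangle\langle f_2,v_1\rangle$ and triple products $\{F,w,G\}=[F,w]\cdot G$, $\{w,F,u\}=-[F,w]\cdot u$, where $F,G\in\bigvee^2\mathcal V^-$, $w,u\in\bigvee^2\mathcal V^+$, $L$ acts on $\bigvee^2\mathcal V^\pm$ by $x\cdot(a\vee b)=(x\cdot a)\vee b+a\vee(x\cdot b)$, and $[F,w]\in L$ is determined by $b(x,[F,w])=\langle x\cdot F,w\rangle$ for all $x\in L$. For $\lambda\in\mathbb F$, the tensor-shift $\mathcal V^{[\lambda]}$ has the same spaces and the same form as $\mathcal V$,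 and triple products $\{x,y,z\}_{[\lambda]}=\{x,y,z\}+\lambda\langle x,y\rangle z$. *)

(* Defs.v *)
From HB Require Import structures.
From mathcomp Require Import all_boot all_order all_algebra ring.

Set Implicit Arguments.
Unset Strict Implicit.
Unset Printing Implicit Defensive.

Import GRing.Theory.
Local Open Scope ring_scope.

Section LinearTools.
Variable F : fieldType.

Definition mkLin (U W : lmodType F) (f : U -> W) (lf : linear f) :
  {linear U -> W} := HB.pack f (GRing.isLinear.Build F U W *:%R f lf).

Section Lin.
Variables (U W : lmodType F) (f : U -> W) (lf : linear f).
Lemma lin_sum I r (P : pred I) h :
  f (\sum_(i <- r | P i) h i) = \sum_(i <- r | P i) f (h i).
Proof. exact: (linear_sum (mkLin lf)). Qed.
Lemma linZ k u : f (k *: u) = k *: f u.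
Proof. exact: (linearZZ (mkLin lf)). Qed.
Lemma linD u v : f (u + v) = f u + f v.
Proof. exact: (linearD (mkLin lf)). Qed.
Lemma lin0 : f 0 = 0.
Proof. exact: (linear0 (mkLin lf)). Qed.
Lemma linN u : f (- u) = - f u.
Proof. exact: (linearN (mkLin lf)). Qed.
End Lin.

Definition bilin (U W X : lmodType F) (g : U -> W -> X) : Prop :=
  (forall w, linear (g^~ w)) /\ (forall u, linear (g u)).

Section Bilin.
Variables (U W X : lmodType F) (g : U -> W -> X) (bg : bilin g).

Lemma bilinPl w k a b : g (k *: a + b) w = k *: g a w + g b w.
Proof. exact: (bg.1 w). Qed.
Lemma bilinPr u k a b : g u (k *: a + b) = k *: g u a + g u b.
Proof. exact: (bg.2 u). Qed.
Lemma bilinDl w a b : g (a + b) w = g a w + g b w.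
Proof. by have := bilinPl w 1 a b; rewrite !scale1r. Qed.
Lemma bilinDr u a b : g u (a + b) = g u a + g u b.
Proof. by have := bilinPr u 1 a b; rewrite !scale1r. Qed.
Lemma bilin0l w : g 0 w = 0.
Proof. exact: (linear0 (mkLin (bg.1 w))). Qed.
Lemma bilin0r u : g u 0 = 0.
Proof. exact: (linear0 (mkLin (bg.2 u))). Qed.
Lemma bilinZl w k a : g (k *: a) w = k *: g a w.
Proof. by have := bilinPl w k a 0; rewrite !addr0 bilin0l addr0. Qed.
Lemma bilinZr u k a : g u (k *: a) = k *: g u a.
Proof. by have := bilinPr u k a 0; rewrite !addr0 bilin0r addr0. Qed.
Lemma bilinNl w a : g (- a) w = - g a w.
Proof. by rewrite -scaleN1r bilinZl scaleN1r. Qed.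
Lemma bilinNr u a : g u (- a) = - g u a.
Proof. by rewrite -scaleN1r bilinZr scaleN1r. Qed.
Lemma bilin_suml w I r (P : pred I) h :
  g (\sum_(i <- r | P i) h i) w = \sum_(i <- r | P i) g (h i) w.
Proof. exact: (linear_sum (mkLin (bg.1 w))). Qed.
Lemma bilin_sumr u I r (P : pred I) h :
  g u (\sum_(i <- r | P i) h i) = \sum_(i <- r | P i) g u (h i).
Proof. exact: (linear_sum (mkLin (bg.2 u))). Qed.
End Bilin.

Definition bilin_form (U W : lmodType F) (b : U -> W -> F) : Prop :=
  bilin (b : U -> W -> F^o).

Definition nondeg_form (U W : lmodType F) (b : U -> W -> F) : Prop :=
  (forall x, (forall y, b x y = 0) -> x = 0) /\
  (forall y, (forall x, b x y = 0) -> y = 0).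

(* For nondegenerate b, the unique y : W such that b x y = phi x for all x. *)
Definition riesz (U W : vectType F) (b : U -> W -> F) (phi : U -> F) : W :=
  ((linfun (fun y : W => linfun (fun x : U => b x y : F^o)))^-1)%VF
    (linfun (phi : U -> F^o)).

Section Riesz.
Variables (U W : vectType F) (b : U -> W -> F).
Hypotheses (bb : bilin_form b) (nb : nondeg_form b).

Lemma bilin_form_flip : bilin_form (fun w u => b u w).
Proof. by case: bb. Qed.

Let row (y : W) : 'Hom(U, F^o) := linfun (fun x : U => b x y : F^o).
Fact riesz_rowE y x : row y x = b x y.
Proof. by rewrite /row (lfunE (mkLin (bb.1 y))). Qed.
Fact riesz_row_lin : linear row.
Proof.
move=> k y z; apply/lfunP => x; rewrite add_lfunE scale_lfunE !riesz_rowE.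
exact: (bb.2 x).
Qed.
Fact riesz_linfunE y : linfun row y = row y.
Proof. by rewrite (lfunE (mkLin riesz_row_lin)). Qed.
Fact riesz_ker : lker (linfun row) == 0%VS.
Proof.
apply/lker0P => y z; rewrite !riesz_linfunE => e; apply/eqP.
rewrite -subr_eq0; apply/eqP/nb.2 => x.
by rewrite (bilinDr bb) (bilinNr bb) -!riesz_rowE e subrr.
Qed.
Fact riesz_dim : (dim W <= dim U)%N /\ (dim U = dim W -> limg (linfun row) = fullv).
Proof.
have d : (\dim (limg (linfun row)) = dim W)%N.
  have := limg_ker_dim (linfun row) fullv.
  by rewrite (eqP riesz_ker) capv0 dimv0 add0n dimvf.
have dH : (\dim (fullv : {vspace 'Hom(U, F^o)}) = dim U)%N.
  by rewrite dimvf /dim /= muln1.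
split=> [|e]; first by rewrite -d -dH dimvS ?subvf.
by apply/eqP; rewrite eqEdim subvf d dH e leqnn.
Qed.
End Riesz.

Lemma rieszP (U W : vectType F) (b : U -> W -> F) (phi : U -> F) x :
  bilin_form b -> nondeg_form b -> linear (phi : U -> F^o) ->
  b x (riesz b phi) = phi x.
Proof.
move=> bb nb lphi; rewrite -(riesz_rowE bb) -(riesz_linfunE bb) /riesz.
set R := linfun (fun y : W => _).
have fl : nondeg_form (fun w u => b u w) by case: nb.
have [dWU full] := riesz_dim bb nb.
have [dUW _] := riesz_dim (bilin_form_flip bb) fl.
have {}full : limg R = fullv by apply: full; apply/eqP; rewrite eqn_leq dUW.
by rewrite (limg_lfunVK (_ : _ \in limg R)) ?full ?memvf // (lfunE (mkLin lphi)).
Qed.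
End LinearTools.

(* The symmetric square in coordinates: a function on the pairs i <= j of     *)
(* indices of a basis (e_i) of V is the vector with these coordinates on the  *)
(* basis (e_i \/ e_j)_(i <= j). Lemmas sym2_lift_vee and sym2_ext are the     *)
(* universal property: symmetric bilinear maps on V factor uniquely as linear *)
(* maps through vee.                                                          *)
Section SymmetricSquare.
Variables (F : fieldType) (V : vectType F).

Notation e := (vbasis (fullv : {vspace V})).

Definition sym2_index :=
  {ij : 'I_(\dim {:V}) * 'I_(\dim {:V}) | (ij.1 <= ij.2)%N}.

Definition sym2T := {ffun sym2_index -> F^o}.

Definition vee (a b : V) : sym2T := [ffun ij : sym2_index =>
  let i := (val ij).1 in let j := (val ij).2 in
  if i == j then coord e i a * coord e i b
  else coord e i a * coord e j b + coord e j a * coord e i b].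

Definition sym2_lift (W : lmodType F) (g : V -> V -> W) (S : sym2T) : W :=
  \sum_(ij : sym2_index) S ij *: g e`_(val ij).1 e`_(val ij).2.

Lemma veeC a b : vee a b = vee b a.
Proof.
apply/ffunP => ij; rewrite !ffunE /=; case: ifP => _; first by rewrite mulrC.
by rewrite addrC mulrC [X in _ + X]mulrC.
Qed.

Lemma vee_bilin : bilin vee.
Proof.
suff l b : linear (vee^~ b).
  split=> // a k u v; rewrite ![vee a _]veeC; exact: l.
move=> k u v; apply/ffunP => ij; rewrite !ffunE /= !linearP /=.
rewrite /GRing.scale /=; case: ifP => _; ring.
Qed.

Lemma sym2_lift_linear (W : lmodType F) (g : V -> V -> W) : linear (sym2_lift g).
Proof.
move=> k S T; rewrite /sym2_lift scaler_sumr -big_split /=.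
by apply: eq_bigr => ij _; rewrite !ffunE scalerDl scalerA.
Qed.

Lemma coord_e (a : V) : a = \sum_i coord e i a *: e`_i.
Proof. exact: coord_vbasis (memvf a). Qed.

Lemma coord_ee (i j : 'I_(\dim {:V})) : coord e i e`_j = (i == j)%:R.
Proof. by rewrite coord_free 1?eq_sym ?(basis_free (vbasisP _)). Qed.

Lemma sum_sym2_index (W : zmodType) n (G : 'I_n -> 'I_n -> W) :
  \sum_i \sum_j G i j =
  \sum_(ij : {ij : 'I_n * 'I_n | (ij.1 <= ij.2)%N})
    (if (val ij).1 == (val ij).2 then G (val ij).1 (val ij).1
     else G (val ij).1 (val ij).2 + G (val ij).2 (val ij).1).
Proof.
pose H (p : 'I_n * 'I_n) := if p.1 == p.2 then G p.1 p.1
  else G p.1 p.2 + G p.2 p.1.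
rewrite (eq_bigr (fun ij => H (val ij))) // pair_big /=.
have -> : \sum_(ij : {ij : 'I_n * 'I_n | (ij.1 <= ij.2)%N}) H (val ij) =
    \sum_(p : 'I_n * 'I_n | (p.1 <= p.2)%N) H p.
  rewrite [RHS](reindex_omap (val : {ij : 'I_n * 'I_n | (ij.1 <= ij.2)%N} -> _)
    insub) /=; last by move=> p le_p; rewrite insubT.
  by apply: eq_bigl => -[p le_p] /=; rewrite insubT ?le_p /= eqxx.
rewrite (bigID [pred p : 'I_n * 'I_n | p.1 <= p.2]%N) /=.
rewrite [X in _ + X](reindex (fun p : 'I_n * 'I_n => (p.2, p.1))) /=; last first.
  by apply: onW_bij; exists (fun p => (p.2, p.1)); case.
rewrite big_mkcond [X in _ + X]big_mkcond -big_split [RHS]big_mkcond /=.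
apply: eq_bigr => -[i j] _ /=; rewrite /H /= -ltnNge -val_eqE /=.
case: ltngtP => [||/val_inj->] //=; by rewrite ?addr0 ?add0r.
Qed.

Lemma sym2_lift_vee (W : lmodType F) (g : V -> V -> W) a b :
  bilin g -> (forall u v, g u v = g v u) -> sym2_lift g (vee a b) = g a b.
Proof.
move=> bg gC; rewrite [in RHS](coord_e a) [in RHS](coord_e b).
rewrite (bilin_suml bg); under eq_bigr do rewrite (bilin_sumr bg).
rewrite sum_sym2_index; apply: eq_bigr => ij _; rewrite ffunE /=.
case: eqP => [<-|_]; rewrite !(bilinZl bg) !(bilinZr bg) !scalerA //.
by rewrite [g _ e`_(val ij).1]gC -scalerDl.
Qed.

Lemma sym2_lift_vee_id S : sym2_lift vee S = S.
Proof.
apply/ffunP => ij; rewrite /sym2_lift sum_ffunE (bigD1 ij) //= big1 => [|kl].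
  rewrite addr0 !ffunE /= !coord_ee eqxx /= /GRing.scale /=.
  rewrite [(val ij).2 == _]eq_sym; case: eqP => _ /=; first by rewrite !mulr1.
  by rewrite eqxx !mulr1 mulr0 addr0 mulr1.
rewrite !ffunE /= !coord_ee -val_eqE => ne; rewrite /GRing.scale /=.
suff -> : (if (val ij).1 == (val ij).2 then
   ((val ij).1 == (val kl).1)%:R * ((val ij).1 == (val kl).2)%:R
  else ((val ij).1 == (val kl).1)%:R * ((val ij).2 == (val kl).2)%:R +
       ((val ij).2 == (val kl).1)%:R * ((val ij).1 == (val kl).2)%:R) = 0 :> F.
  exact: mulr0.
case: ij kl ne => -[i j] /= ij [[k l] /= kl]; rewrite xpair_eqE => ne.
rewrite -!natrM !mulnb -natrD.
case: eqP => [eij|/eqP nij].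
  by rewrite -eij in ne *; rewrite ![i == _]eq_sym (negPf ne).
rewrite [i == k]eq_sym [j == l]eq_sym (negPf ne) add0n.
case: eqP => [ejk|//]; case: eqP => [eil|//]; case/eqP: nij; apply/val_inj/eqP.
by rewrite eqn_leq ij ejk eil kl.
Qed.

Lemma sym2_ext (W : lmodType F) (h1 h2 : sym2T -> W) : linear h1 -> linear h2 ->
  (forall a b, h1 (vee a b) = h2 (vee a b)) -> h1 =1 h2.
Proof.
move=> l1 l2 eqh S; rewrite -(sym2_lift_vee_id S) /sym2_lift.
rewrite (lin_sum l1) (lin_sum l2).
by apply: eq_bigr => ij _; rewrite (linZ l1) (linZ l2) eqh.
Qed.
End SymmetricSquare.

Section SymmetricSquareMaps.
Variable F : fieldType.

Lemma sym2_lift_lin (V : vectType F) (X W : lmodType F) (g : X -> V -> V -> W) S :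
  (forall a b, linear (fun x => g x a b)) -> linear (fun x => sym2_lift (g x) S).
Proof.
move=> lg k x y; rewrite /sym2_lift scaler_sumr -big_split /=.
by apply: eq_bigr => ij _; rewrite lg scalerDr !scalerA [k * _]mulrC.
Qed.

Lemma sym2_ext2 (U V : vectType F) (W : lmodType F)
    (h1 h2 : sym2T U -> sym2T V -> W) : bilin h1 -> bilin h2 ->
  (forall a b c d, h1 (vee a b) (vee c d) = h2 (vee a b) (vee c d)) ->
  forall S T, h1 S T = h2 S T.
Proof.
move=> b1 b2 eqh S T; apply: (sym2_ext (b1.1 T) (b2.1 T)) => a b.
by apply: (sym2_ext (b1.2 _) (b2.2 _)) => c d; apply: eqh.
Qed.

(* The form on symmetric squares induced by a form between U and W. *)
Definition sym2_form (U W : vectType F) (b : U -> W -> F)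
    (S : sym2T U) (w : sym2T W) : F :=
  sym2_lift (fun f1 f2 => sym2_lift (fun v1 v2 =>
    b f1 v1 * b f2 v2 + b f1 v2 * b f2 v1 : F^o) w) S.

(* The derivation extension of an endomorphism to the symmetric square. *)
Definition sym2_der (V : vectType F) (g : V -> V) : sym2T V -> sym2T V :=
  sym2_lift (fun a b => vee (g a) b + vee a (g b)).

Section Der.
Variables (V : vectType F) (g : V -> V) (lg : linear g).

Lemma sym2_der_vee a b : sym2_der g (vee a b) = vee (g a) b + vee a (g b).
Proof.
have bv := @vee_bilin _ V.
apply: (@sym2_lift_vee _ _ _ (fun a b => vee (g a) b + vee a (g b))) => /=.
  by split=> [c|c] k u v; rewrite lg ?(bilinPl bv) ?(bilinPr bv) scalerDr addrACA.
by move=> u v; rewrite addrC veeC [vee (g u) _]veeC.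
Qed.

Lemma sym2_der_linear : linear (sym2_der g).
Proof. exact: sym2_lift_linear. Qed.
End Der.

Section Form.
Variables (U W : vectType F) (b : U -> W -> F) (bb : bilin_form b).

Let inner (w : sym2T W) f1 f2 := sym2_lift (fun v1 v2 =>
    b f1 v1 * b f2 v2 + b f1 v2 * b f2 v1 : F^o) w.

Lemma sym2_form_bilin : bilin_form (sym2_form b).
Proof.
split=> [w|S]; first exact: sym2_lift_linear.
move=> k u v; rewrite /sym2_form.
rewrite (_ : sym2_lift _ S = sym2_lift (fun f1 f2 => k *: inner u f1 f2 + inner v f1 f2) S); last first.
  by apply: eq_bigr => ij _; rewrite [X in _ *: X]sym2_lift_linear.
rewrite /sym2_lift [X in X + _]scaler_sumr -big_split /=.
by apply: eq_bigr => ij _; rewrite scalerDr !scalerA [k * _]mulrC.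
Qed.

Lemma sym2_form_vee f1 f2 v1 v2 :
  sym2_form b (vee f1 f2) (vee v1 v2) = b f1 v1 * b f2 v2 + b f1 v2 * b f2 v1.
Proof.
have bE1 v k x y : b (k *: x + y) v = k * b x v + b y v := bb.1 v k x y.
have bE2 x k u v : b x (k *: u + v) = k * b x u + b x v := bb.2 x k u v.
rewrite /sym2_form (@sym2_lift_vee _ _ F^o (inner (vee v1 v2))).
- rewrite /inner (@sym2_lift_vee _ _ F^o (fun v1 v2 => b f1 v1 * b f2 v2 + b f1 v2 * b f2 v1 : F^o)) //.
    by split=> c k x y; rewrite !bE2 /GRing.scale /=; ring.
  by move=> x y; rewrite addrC.
- split=> c; apply: (@sym2_lift_lin _ _ F^o) => x y k u v; rewrite !bE1 /GRing.scale /=; ring.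
- move=> x y; apply: eq_bigr => ij _; congr (_ *: _); rewrite addrC.
  by rewrite mulrC [X in _ + X]mulrC.
Qed.
End Form.

Lemma sym2_form_flip (U W : vectType F) (b : U -> W -> F) S w :
  bilin_form b -> sym2_form b S w = sym2_form (fun v f => b f v) w S.
Proof.
move=> bb; have fb := bilin_form_flip bb.
apply: (@sym2_ext2 _ _ F^o (sym2_form b) (fun S w => sym2_form (fun v f => b f v) w S)).
- exact: sym2_form_bilin.
- exact/bilin_form_flip/sym2_form_bilin.
by move=> f1 f2 v1 v2; rewrite !sym2_form_vee // [b f1 v2 * _]mulrC.
Qed.

Lemma sym2_form_nondegl (U W : vectType F) (b : U -> W -> F) :
  2%N \notin [pchar F] -> bilin_form b -> nondeg_form b ->
  forall S, (forall w, sym2_form b S w = 0) -> S = 0.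
Proof.
move=> ch2 bb nb S S0; apply/ffunP => ij; rewrite ffunE.
pose e := vbasis (fullv : {vspace U}).
pose v i := riesz b (coord e i).
have vE i x : b x (v i) = coord e i x.
  by rewrite rieszP // => k y z; rewrite linearP.
have n2 : 2%:R != 0 :> F by apply: contra ch2 => e2; rewrite inE e2.
pose i := (val ij).1; pose j := (val ij).2.
pose c : F := if i == j then 2%:R else 1.
have c0 : c != 0 by rewrite /c; case: ifP => // _; exact: oner_neq0.
suff E : sym2_form b S (vee (v i) (v j)) = c * S ij.
  by apply/eqP; move/eqP: E; rewrite S0 eq_sym mulf_eq0 (negPf c0).
apply: (@sym2_ext _ _ F^o (fun S => sym2_form b S (vee (v i) (v j))) (fun S => c * S ij)).
- exact: ((sym2_form_bilin b).1 (vee (v i) (v j))).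
- by move=> k x y; rewrite !ffunE /GRing.scale /=; ring.
move=> x y; rewrite sym2_form_vee // !vE ffunE /= /c /i /j.
by case: eqP => [->|_]; ring.
Qed.

Lemma sym2_form_nondeg (U W : vectType F) (b : U -> W -> F) :
  2%N \notin [pchar F] -> bilin_form b -> nondeg_form b ->
  nondeg_form (sym2_form b).
Proof.
move=> ch2 bb nb; split; first exact: sym2_form_nondegl.
move=> w w0; apply: (@sym2_form_nondegl _ _ (fun v f => b f v)) => //.
- exact: bilin_form_flip.
- by case: nb.
by move=> S; rewrite -sym2_form_flip.
Qed.

Lemma sym2_form_skew (U W : vectType F) (b : U -> W -> F) gU gW :
  bilin_form b -> linear gU -> linear gW ->
  (forall f v, b (gU f) v = - b f (gW v)) ->
  forall S w, sym2_form b (sym2_der gU S) w = - sym2_form b S (sym2_der gW w).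
Proof.
move=> bb lU lW sk; have bs := sym2_form_bilin b.
have dU := sym2_der_linear gU; have dW := sym2_der_linear gW.
apply: (@sym2_ext2 _ _ F^o (fun S w => sym2_form b (sym2_der gU S) w)
  (fun S w => - sym2_form b S (sym2_der gW w))).
- by split=> u k x y; rewrite ?dU ?(bilinPl bs) ?(bilinPr bs).
- split=> u k x y; rewrite ?dW ?(bilinPl bs) ?(bilinPr bs) /GRing.scale /=; ring.
move=> f1 f2 v1 v2; rewrite !sym2_der_vee // (bilinDl bs) (bilinDr bs).
rewrite !sym2_form_vee // !sk; ring.
Qed.
End SymmetricSquareMaps.

Section JordanPairs.
Variable F : fieldType.

Definition trilin (U W : lmodType F) (t : U -> W -> U -> U) : Prop :=
  [/\ forall y z, linear (fun x => t x y z),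
      forall x z, linear (fun y => t x y z) &
      forall x y, linear (t x y)].

(* [D_(x,y), D_(z,w)] = D_(D_(x,y) z, w) - D_(z, D_(y,x) w), on the space U. *)
Definition gjp_identity (U W : lmodType F)
    (tU : U -> W -> U -> U) (tW : W -> U -> W -> W) : Prop :=
  forall x y z w u,
    tU x y (tU z w u) - tU z w (tU x y u) =
    tU (tU x y z) w u - tU z (tW y x w) u.

Definition is_gjp (U W : lmodType F)
    (tU : U -> W -> U -> U) (tW : W -> U -> W -> W) : Prop :=
  [/\ trilin tU, trilin tW, gjp_identity tU tW & gjp_identity tW tU].

Definition is_gjp_form (U W : lmodType F) (tU : U -> W -> U -> U)
    (tW : W -> U -> W -> W) (b : U -> W -> F) : Prop :=
  [/\ bilin_form b, nondeg_form b,
      forall x y z w, b (tU x y z) w = b z (tW y x w),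
      forall x y z w, b (tU x y z) w = b (tU z w x) y &
      forall x y z w, b x (tW y z w) = b z (tW w x y)].

Record gjPair := GJPair {
  gj_neg : lmodType F;
  gj_pos : lmodType F;
  gj_tneg : gj_neg -> gj_pos -> gj_neg -> gj_neg;
  gj_tpos : gj_pos -> gj_neg -> gj_pos -> gj_pos;
  gj_axioms : is_gjp gj_tneg gj_tpos }.

Record metricGJP := MetricGJP {
  mg_neg : vectType F;
  mg_pos : vectType F;
  mg_tneg : mg_neg -> mg_pos -> mg_neg -> mg_neg;
  mg_tpos : mg_pos -> mg_neg -> mg_pos -> mg_pos;
  mg_form : mg_neg -> mg_pos -> F;
  mg_gjp_axioms : is_gjp mg_tneg mg_tpos;
  mg_form_axioms : is_gjp_form mg_tneg mg_tpos mg_form }.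

Definition gjp_of_metric (V : metricGJP) : gjPair := GJPair (mg_gjp_axioms V).

Definition is_gjp_iso (V W : gjPair) (fn : gj_neg V -> gj_neg W)
    (fp : gj_pos V -> gj_pos W) : Prop :=
  [/\ linear fn /\ linear fp, bijective fn /\ bijective fp,
      forall x y z, fn (gj_tneg x y z) = gj_tneg (fn x) (fp y) (fn z) &
      forall x y z, fp (gj_tpos x y z) = gj_tpos (fp x) (fn y) (fp z)].

Definition is_metric_iso (V W : metricGJP) (fn : mg_neg V -> mg_neg W)
    (fp : mg_pos V -> mg_pos W) : Prop :=
  @is_gjp_iso (gjp_of_metric V) (gjp_of_metric W) fn fp /\
  forall x y, mg_form (fn x) (fp y) = mg_form x y.

Definition metric_isomorphic (V W : metricGJP) : Prop :=
  exists (fn : mg_neg V -> mg_neg W) (fp : mg_pos V -> mg_pos W),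
    is_metric_iso fn fp.

Section Rescale.
Variables (c : F) (c0 : c != 0) (V : metricGJP).

Fact rescale_form_axioms :
  is_gjp_form (@mg_tneg V) (@mg_tpos V) (fun x y => c * mg_form x y).
Proof.
have [bb [nl nr] a1 a2 a3] := mg_form_axioms V; split.
- split=> u k x y; rewrite ?[mg_form _ u](bb.1 u) ?(bb.2 u) /GRing.scale /=; ring.
- split=> [x x0|y y0]; [apply: nl => y | apply: nr => x].
    by apply/eqP; have /eqP := x0 y; rewrite mulf_eq0 (negPf c0).
  by apply/eqP; have /eqP := y0 x; rewrite mulf_eq0 (negPf c0).
- by move=> x y z w; rewrite a1.
- by move=> x y z w; rewrite a2.
- by move=> x y z w; rewrite a3.
Qed.

(* The same pair, with the form multiplied by c. *)
Definition rescale : metricGJP := MetricGJP (mg_gjp_axioms V) rescale_form_axioms.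
End Rescale.

Fact shift_aux (lam : F) (U W : vectType F) (tU : U -> W -> U -> U)
    (tW : W -> U -> W -> W) (b : U -> W -> F) :
  bilin_form b -> trilin tU -> gjp_identity tU tW ->
  (forall x y z w, b (tU x y z) w = b z (tW y x w)) ->
  let tU' := fun x y z => tU x y z + (lam * b x y) *: z in
  let tW' := fun y x z => tW y x z + (lam * b x y) *: z in
  trilin tU' /\ gjp_identity tU' tW'.
Proof.
move=> bb [t1 t2 t3] idU a1 tU' tW'.
have bE1 v k x y : b (k *: x + y) v = k * b x v + b y v := bb.1 v k x y.
have bE2 x k u v : b x (k *: u + v) = k * b x u + b x v := bb.2 x k u v.
split; first split.
- move=> y z k u v; rewrite /tU' t1 bE1 mulrDr mulrCA.
  by rewrite scalerDl scalerDr scalerA addrACA.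
- move=> x z k u v; rewrite /tU' t2 bE2 mulrDr mulrCA.
  by rewrite scalerDl scalerDr scalerA addrACA.
- move=> x y k u v; rewrite /tU' t3 !scalerDr !scalerA [k * _]mulrC.
  by rewrite addrACA.
move=> x y z w u; rewrite /tU' /tW'; set p := lam * b x y; set q := lam * b z w.
have cancelr (A B X Y : U) : X = Y -> (A + X) - (B + Y) = A - B.
  by move=> ->; rewrite opprD addrACA subrr addr0.
rewrite ![_ + _ *: z]addrC ![_ + _ *: w]addrC t1 t2 bE1 bE2 a1.
rewrite [RHS]cancelr // ![_ *: tU z w u + _]addrC [RHS]cancelr // -idU.
rewrite !(linD (t3 _ _)) !(linZ (t3 _ _)) -[X in X - _]addrA -[X in _ - X]addrA.
apply: cancelr.
by rewrite !scalerDr !scalerA [q * p]mulrC addrCA.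
Qed.

Section TensorShift.
Variables (lam : F) (V : metricGJP).

Definition shift_tneg (x : mg_neg V) (y : mg_pos V) (z : mg_neg V) : mg_neg V :=
  mg_tneg x y z + (lam * mg_form x y) *: z.
Definition shift_tpos (y : mg_pos V) (x : mg_neg V) (z : mg_pos V) : mg_pos V :=
  mg_tpos y x z + (lam * mg_form x y) *: z.

Fact shift_gjp_axioms : is_gjp shift_tneg shift_tpos.
Proof.
have [bb _ a1 _ _] := mg_form_axioms V.
have [tn tp idn idp] := mg_gjp_axioms V.
have [ln en] := shift_aux lam bb tn idn a1.
have [|lp ep] := shift_aux lam (bilin_form_flip bb) tp idp; last by split.
by move=> x y z w; rewrite a1.
Qed.

Fact shift_form_axioms : is_gjp_form shift_tneg shift_tpos (@mg_form V).
Proof.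
have [bb nb a1 a2 a3] := mg_form_axioms V; split=> //.
- move=> x y z w; rewrite (bilinDl bb) (bilinDr bb) a1.
  by rewrite (bilinZl bb) (bilinZr bb).
- move=> x y z w; rewrite !(bilinDl bb) a2 !(bilinZl bb) /GRing.scale /=; ring.
- move=> x y z w; rewrite !(bilinDr bb) a3 !(bilinZr bb) /GRing.scale /=; ring.
Qed.

Definition tensor_shift : metricGJP :=
  MetricGJP shift_gjp_axioms shift_form_axioms.
End TensorShift.

Section ActionPair.
Variables (X Y L : lmodType F) (an : L -> X -> X) (ap : L -> Y -> Y).
Variables (br : X -> Y -> L) (li : L -> L -> L).
Hypotheses (bn : bilin an) (bp : bilin ap) (bs : bilin br).
Hypothesis an_li : forall x y S, an (li x y) S = an x (an y S) - an y (an x S).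
Hypothesis ap_li : forall x y S, ap (li x y) S = ap x (ap y S) - ap y (ap x S).
Hypothesis li_br : forall y S w, li y (br S w) = br (an y S) w + br S (ap y w).

Fact action_gjp :
  is_gjp (fun S w T => an (br S w) T) (fun w S u => - ap (br S w) u).
Proof.
split.
- split=> [w u|S u|S w] k x y.
  + by rewrite (bilinPl bs) (bilinPl bn).
  + by rewrite (bilinPr bs) (bilinPl bn).
  + by rewrite (bilinPr bn).
- split=> [w u|S u|S w] k x y.
  + by rewrite (bilinPr bs) (bilinPl bp) opprD scalerN.
  + by rewrite (bilinPl bs) (bilinPl bp) opprD scalerN.
  + by rewrite (bilinPr bp) opprD scalerN.
- move=> x y z w u; rewrite -an_li li_br (bilinDl bn) (bilinNr bs).
  by rewrite (bilinNl bn) opprK.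
- move=> x y z w u; rewrite !(bilinNr bp) !opprK -ap_li li_br (bilinDl bp).
  by rewrite (bilinNr bs) (bilinNl bp) !opprK addrC.
Qed.

Variables (sf : X -> Y -> F) (b : L -> L -> F).
Hypotheses (sfb : bilin_form sf) (sfn : nondeg_form sf).
Hypothesis sf_skew : forall x S w, sf (an x S) w = - sf S (ap x w).
Hypothesis b_sym : forall x y, b x y = b y x.
Hypothesis b_br : forall x S w, b x (br S w) = sf (an x S) w.

Fact action_gjp_form : is_gjp_form
  (fun S w T => an (br S w) T) (fun w S u => - ap (br S w) u) sf.
Proof.
have sfN S w : sf S (- w) = - sf S w := bilinNr sfb S w.
split=> // x y z w.
- by rewrite sf_skew sfN.
- by rewrite -!b_br b_sym.
- by rewrite !sfN -!sf_skew -!b_br b_sym.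
Qed.
End ActionPair.

Section InnerStructure.
Variable V : metricGJP.
Notation Vn := (mg_neg V).
Notation Vp := (mg_pos V).
Notation EE := ('End(Vn) * 'End(Vp))%type.

Definition nu (f : Vn) (v : Vp) : EE :=
  (linfun (mg_tneg f v), - linfun (mg_tpos v f)).

Definition commutator (x y : EE) : EE :=
  ((x.1 \o y.1)%VF - (y.1 \o x.1)%VF, (x.2 \o y.2)%VF - (y.2 \o x.2)%VF).

Definition instr_gens : seq (Vn * Vp) :=
  [seq (f, v) | f <- vbasis (fullv : {vspace Vn}), v <- vbasis (fullv : {vspace Vp})].

(* As nu is bilinear, this is the span of all nu f v: see mem_nu, instr_ind.  *)
Definition instr : {vspace EE} :=
  <<map_tuple (fun p => nu p.1 p.2) (in_tuple instr_gens)>>%VS.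

Definition instrT := subvs_of instr.

Let bb : bilin_form (@mg_form V). Proof. by case: (mg_form_axioms V). Qed.
Let nb : nondeg_form (@mg_form V). Proof. by case: (mg_form_axioms V). Qed.
Let a1 (x : Vn) (y : Vp) z w : mg_form (mg_tneg x y z) w = mg_form z (mg_tpos y x w).
Proof. by case: (mg_form_axioms V). Qed.
Let a2 (x : Vn) (y : Vp) z w : mg_form (mg_tneg x y z) w = mg_form (mg_tneg z w x) y.
Proof. by case: (mg_form_axioms V). Qed.
Let tn : trilin (@mg_tneg V). Proof. by case: (mg_gjp_axioms V). Qed.
Let tp : trilin (@mg_tpos V). Proof. by case: (mg_gjp_axioms V). Qed.
Let idn : gjp_identity (@mg_tneg V) (@mg_tpos V).
Proof. by case: (mg_gjp_axioms V). Qed.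
Let idp : gjp_identity (@mg_tpos V) (@mg_tneg V).
Proof. by case: (mg_gjp_axioms V). Qed.

Lemma nu1E f v z : (nu f v).1 z = mg_tneg f v z.
Proof. by case: tn => _ _ l; rewrite /= (lfunE (mkLin (l f v))). Qed.
Lemma nu2E f v z : (nu f v).2 z = - mg_tpos v f z.
Proof. by case: tp => _ _ l; rewrite /= opp_lfunE (lfunE (mkLin (l v f))). Qed.

Lemma EE_ext (x y : EE) : (forall z, x.1 z = y.1 z) -> (forall z, x.2 z = y.2 z) -> x = y.
Proof. by case: x y => [x1 x2] [y1 y2] /= /lfunP -> /lfunP ->. Qed.

Lemma EE_1 k (x y : EE) z : (k *: x + y).1 z = k *: x.1 z + y.1 z.
Proof. by rewrite add_lfunE scale_lfunE. Qed.
Lemma EE_2 k (x y : EE) z : (k *: x + y).2 z = k *: x.2 z + y.2 z.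
Proof. by rewrite add_lfunE scale_lfunE. Qed.

Lemma nu_bilin : bilin nu.
Proof.
case: tn tp => [n1 n2 _] [p1 p2 _].
split=> u k x y; apply: EE_ext => z; rewrite ?EE_1 ?EE_2 ?nu1E ?nu2E.
- exact: n1.
- by rewrite p2 opprD scalerN.
- exact: n2.
- by rewrite p1 opprD scalerN.
Qed.

Lemma mem_nu f v : nu f v \in instr.
Proof.
rewrite (coord_e f) (coord_e v) (bilin_suml nu_bilin) memv_suml // => i _.
rewrite (bilin_sumr nu_bilin) memv_suml // => j _.
rewrite (bilinZl nu_bilin) (bilinZr nu_bilin) !memvZ // memv_span //.
apply/mapP; exists ((vbasis fullv)`_i, (vbasis fullv)`_j) => //=.
by apply: allpairs_f; rewrite mem_nth ?size_tuple.
Qed.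

Lemma instr_ind (P : EE -> Prop) :
  (forall f v, P (nu f v)) -> (forall k x y, P x -> P y -> P (k *: x + y)) ->
  forall x, x \in instr -> P x.
Proof.
move=> Pnu PD x /coord_span ->.
have P0 : P 0 by rewrite -(bilin0l nu_bilin 0).
elim/big_ind: _ => // [y z Py Pz | i _]; first by rewrite -[y]scale1r; apply: PD.
rewrite -[_ *: _]addr0; apply: PD => //.
by rewrite -tnth_nth tnth_map; apply: Pnu.
Qed.

Lemma instr_skew x f v : x \in instr -> mg_form (x.1 f) v = - mg_form f (x.2 v).
Proof.
move=> xL; elim/instr_ind: xL f v => [f v g w | k y z Hy Hz f v].
  by rewrite nu1E nu2E (bilinNr bb) opprK a1.
by rewrite EE_1 EE_2 (bilinPl bb) (bilinPr bb) Hy Hz /GRing.scale /=; ring.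
Qed.

Lemma comm1E x y z : (commutator x y).1 z = x.1 (y.1 z) - y.1 (x.1 z).
Proof. by rewrite add_lfunE opp_lfunE !comp_lfunE. Qed.
Lemma comm2E x y z : (commutator x y).2 z = x.2 (y.2 z) - y.2 (x.2 z).
Proof. by rewrite add_lfunE opp_lfunE !comp_lfunE. Qed.

Lemma commutatorPl k x y z :
  commutator (k *: x + y) z = k *: commutator x z + commutator y z.
Proof.
apply: EE_ext => u.
  by rewrite EE_1 !comm1E !EE_1 linearP /= scalerBr opprD addrACA.
by rewrite EE_2 !comm2E !EE_2 linearP /= scalerBr opprD addrACA.
Qed.

Lemma commutatorPr k x y z :
  commutator z (k *: x + y) = k *: commutator z x + commutator z y.
Proof.
apply: EE_ext => u.
  by rewrite EE_1 !comm1E !EE_1 linearP /= scalerBr opprD addrACA.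
by rewrite EE_2 !comm2E !EE_2 linearP /= scalerBr opprD addrACA.
Qed.

Lemma commutator_nu x f v : x \in instr ->
  commutator x (nu f v) = nu (x.1 f) v + nu f (x.2 v).
Proof.
move=> xL; elim/instr_ind: xL f v => [g w f v | k y z Hy Hz f v].
  apply: EE_ext => u.
    rewrite comm1E [RHS]add_lfunE !nu1E nu2E.
    rewrite idn; congr (_ + _); case: tn => _ n2 _.
    by rewrite (linN (n2 f u)).
  rewrite comm2E [RHS]add_lfunE !nu2E nu1E.
  case: tp => p1 p2 p3.
  rewrite !(linN (p3 _ _)) !opprK idp (linN (p1 _ _)) opprK addrC.
  by [].
rewrite commutatorPl Hy Hz EE_1 EE_2 (bilinPl nu_bilin) (bilinPr nu_bilin).
by rewrite scalerDr addrACA.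
Qed.

Lemma commutator_mem x y : x \in instr -> y \in instr -> commutator x y \in instr.
Proof.
move=> xL; elim/instr_ind => [f v | k u v Hu Hv].
  by rewrite commutator_nu // memvD ?mem_nu.
by rewrite commutatorPr memvD ?memvZ.
Qed.

Definition lie (x y : instrT) : instrT :=
  Subvs (commutator_mem (subvsP x) (subvsP y)).

Definition nuL f v : instrT := Subvs (mem_nu f v).

(* b(x, y) is computed by writing y as a combination of elements nu(f, v);    *)
(* the choice is irrelevant, see instr_form_nu and instr_form_unique.         *)
Definition instr_form (x y : instrT) : F :=
  \sum_(k < size instr_gens)
    coord (map_tuple (fun p => nu p.1 p.2) (in_tuple instr_gens)) k (vsval y)
    * mg_form ((vsval x).1 (tnth (in_tuple instr_gens) k).1)
              (tnth (in_tuple instr_gens) k).2.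

Lemma instr_form_bilin : bilin_form instr_form.
Proof.
split=> u k x y; rewrite /instr_form [in RHS]scaler_sumr -big_split /=;
  apply: eq_bigr => i _.
  rewrite [X in mg_form X](_ : _ = k *: (vsval x).1 (tnth (in_tuple instr_gens) i).1
     + (vsval y).1 (tnth (in_tuple instr_gens) i).1); last by rewrite -EE_1.
  by rewrite (bilinPl bb) /GRing.scale /=; ring.
set X := map_tuple _ _.
  have -> : coord X i (k *: vsval x + vsval y) = k * coord X i (vsval x) + coord X i (vsval y).
    exact: (linearP (coord X i)).
  rewrite /GRing.scale /=; ring.
Qed.

Lemma instr_form_nu x f v : instr_form x (nuL f v) = mg_form ((vsval x).1 f) v.
Proof.
rewrite /instr_form.
set X := map_tuple _ _; set G := in_tuple _.
have lev g w : linear (fun P : EE => mg_form (P.1 g) w : F^o).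
  by move=> k P Q; rewrite EE_1 (bilinPl bb).
elim/instr_ind: (subvsP x) => [g w | k P Q HP HQ]; last first.
  rewrite EE_1 (bilinPl bb) -HP -HQ [in RHS]scaler_sumr -big_split /=.
  apply: eq_bigr => i _; rewrite EE_1 (bilinPl bb) /GRing.scale /=; ring.
rewrite nu1E a2 -nu1E [in RHS](coord_span (mem_nu f v)) (lin_sum (lev g w)).
apply: eq_bigr => i _; rewrite (linZ (lev g w)); congr (_ * _).
by rewrite -tnth_nth tnth_map !nu1E a2.
Qed.

Lemma instrT_ind (P : instrT -> Prop) :
  (forall f v, P (nuL f v)) -> (forall k x y, P x -> P y -> P (k *: x + y)) ->
  forall x, P x.
Proof.
move=> Pnu PD [x xL]; suff: exists yL : x \in instr, P (Subvs yL).
  by case=> yL; rewrite (bool_irrelevance xL yL).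
elim/instr_ind: xL => [f v | k y z [yL Py] [zL Pz]].
  by exists (mem_nu f v); apply: Pnu.
exists (memvD (memvZ k yL) zL); have := PD k _ _ Py Pz.
by congr P; apply: val_inj.
Qed.

Lemma instr_form_unique (b : instrT -> instrT -> F) :
  (forall x, linear (b x : instrT -> F^o)) ->
  (forall x f v, b x (nuL f v) = mg_form ((vsval x).1 f) v) ->
  forall x y, b x y = instr_form x y.
Proof.
move=> lb bnu x; elim/instrT_ind => [f v | k y z Hy Hz].
  by rewrite bnu instr_form_nu.
by rewrite (lb x) (bilinPr instr_form_bilin) Hy Hz.
Qed.

Lemma instr_form_sym x y : instr_form x y = instr_form y x.
Proof.
have fb := instr_form_bilin.
elim/instrT_ind: x y => [f v y | k x z Hx Hz y].
  elim/instrT_ind: y => [g w | k x z Hx Hz].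
    by rewrite !instr_form_nu !nu1E a2.
  by rewrite (bilinPl fb) (bilinPr fb) Hx Hz.
by rewrite (bilinPl fb) (bilinPr fb) Hx Hz.
Qed.

Lemma instr_form_nondeg : nondeg_form instr_form.
Proof.
suff H x : (forall y, instr_form x y = 0) -> x = 0.
  by split=> // y y0; apply: H => x; rewrite instr_form_sym.
move=> x0; apply: val_inj; apply: EE_ext => z; rewrite lfunE /=.
  by apply: nb.1 => v; rewrite -instr_form_nu.
by apply: nb.2 => f; apply: oppr_inj; rewrite -(instr_skew _ _ (subvsP x)) -instr_form_nu x0 oppr0.
Qed.

Lemma instr_form_invariant x y z :
  instr_form (lie x y) z = instr_form x (lie y z).
Proof.
have fb := instr_form_bilin.
elim/instrT_ind: z => [f v | k u w Hu Hw]; last first.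
  rewrite (bilinPr fb) Hu Hw -(bilinPr fb); congr instr_form.
  by apply: val_inj; rewrite /= commutatorPr.
rewrite instr_form_nu (_ : lie y _ = nuL ((vsval y).1 f) v + nuL f ((vsval y).2 v)).
  rewrite (bilinDr fb) !instr_form_nu comm1E.
  by rewrite (bilinDl bb) (bilinNl bb) (instr_skew _ _ (subvsP y)) opprK.
by apply: val_inj; rewrite /= commutator_nu // subvsP.
Qed.

(* Action of x in instr(V) on the symmetric squares.                          *)
Definition sym2_actn (x : instrT) : sym2T Vn -> sym2T Vn :=
  sym2_der (vsval x).1.
Definition sym2_actp (x : instrT) : sym2T Vp -> sym2T Vp :=
  sym2_der (vsval x).2.

(* The element [S, w] of instr(V) with b(x, [S, w]) = <x . S, w> for all x.   *)
Definition sym2_bracket (S : sym2T Vn) (w : sym2T Vp) : instrT :=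
  riesz instr_form (fun x => sym2_form (@mg_form V) (sym2_actn x S) w).

Definition sym2_tneg S w T := sym2_actn (sym2_bracket S w) T.
Definition sym2_tpos w S u := - sym2_actp (sym2_bracket S w) u.

Let sf := sym2_form (@mg_form V).
Let sfb : bilin_form sf := sym2_form_bilin _.

Lemma sym2_actn_bilin : bilin sym2_actn.
Proof.
split=> [S|x]; last exact: sym2_der_linear.
apply: sym2_lift_lin => a b k x y; rewrite !EE_1.
have bv := @vee_bilin _ Vn; rewrite (bilinPl bv) (bilinPr bv).
by rewrite scalerDr addrACA.
Qed.

Lemma sym2_actp_bilin : bilin sym2_actp.
Proof.
split=> [S|x]; last exact: sym2_der_linear.
apply: sym2_lift_lin => a b k x y; rewrite !EE_2.
have bv := @vee_bilin _ Vp; rewrite (bilinPl bv) (bilinPr bv).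
by rewrite scalerDr addrACA.
Qed.

Lemma sym2_bracketP x S w :
  instr_form x (sym2_bracket S w) = sf (sym2_actn x S) w.
Proof.
rewrite /sym2_bracket rieszP //; [exact: instr_form_bilin|exact: instr_form_nondeg|].
by move=> k y z; rewrite -/sf (bilinPl sym2_actn_bilin) (bilinPl sfb).
Qed.

Lemma instr_form_inj y z :
  (forall x, instr_form x y = instr_form x z) -> y = z.
Proof.
have fb := instr_form_bilin.
move=> e; apply/eqP; rewrite -subr_eq0; apply/eqP/instr_form_nondeg.2 => x.
by rewrite (bilinDr fb) (bilinNr fb) e subrr.
Qed.

Lemma sym2_bracket_bilin : bilin sym2_bracket.
Proof.
have fb := instr_form_bilin.
split=> u k x y; apply: instr_form_inj => z; rewrite (bilinPr fb) !sym2_bracketP.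
  by rewrite (bilinPr sym2_actn_bilin) (bilinPl sfb).
by rewrite (bilinPr sfb).
Qed.

Lemma sym2_act_skew x S w : sf (sym2_actn x S) w = - sf S (sym2_actp x w).
Proof.
apply: sym2_form_skew => //; try by move=> k u v; rewrite linearP.
by move=> f v; apply: instr_skew; apply: subvsP.
Qed.

Fact sub_sum_cross (Z : zmodType) (A B C D E G : Z) :
  (A - B) + (C - D) = ((A + E) + (G + C)) - ((B + G) + (E + D)).
Proof.
have -> : (A + E) + (G + C) = (A + C) + (E + G) by rewrite [G + C]addrC addrACA.
have -> : (B + G) + (E + D) = (B + D) + (E + G).
  by rewrite [E + D]addrC addrACA [G + E]addrC.
by rewrite [- (_ + (E + G))]opprD [RHS]addrACA subrr addr0 opprD addrACA.
Qed.

Lemma sym2_actn_lie x y S :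
  sym2_actn (lie x y) S = sym2_actn x (sym2_actn y S) - sym2_actn y (sym2_actn x S).
Proof.
have bv := @vee_bilin _ Vn; have ba := sym2_actn_bilin.
apply: (@sym2_ext _ _ _ (sym2_actn (lie x y))
  (fun S => sym2_actn x (sym2_actn y S) - sym2_actn y (sym2_actn x S))).
- exact: ba.2.
- move=> k u v; rewrite !(bilinPr ba) scalerBr opprD addrACA //.
move=> a b; rewrite /sym2_actn !sym2_der_vee; try by move=> k u v; rewrite linearP.
have dd (g : 'End(Vn)) : linear (sym2_der g) by exact: sym2_der_linear.
rewrite !(linD (dd _)) !sym2_der_vee; try by move=> k u v; rewrite linearP.
rewrite !comm1E (bilinDl bv) (bilinDr bv).
by rewrite (bilinNl bv) (bilinNr bv) -sub_sum_cross.
Qed.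

Lemma sym2_actp_lie x y S :
  sym2_actp (lie x y) S = sym2_actp x (sym2_actp y S) - sym2_actp y (sym2_actp x S).
Proof.
have bv := @vee_bilin _ Vp; have ba := sym2_actp_bilin.
apply: (@sym2_ext _ _ _ (sym2_actp (lie x y))
  (fun S => sym2_actp x (sym2_actp y S) - sym2_actp y (sym2_actp x S))).
- exact: ba.2.
- move=> k u v; rewrite !(bilinPr ba) scalerBr opprD addrACA //.
move=> a b; rewrite /sym2_actp !sym2_der_vee; try by move=> k u v; rewrite linearP.
have dd (g : 'End(Vp)) : linear (sym2_der g) by exact: sym2_der_linear.
rewrite !(linD (dd _)) !sym2_der_vee; try by move=> k u v; rewrite linearP.
rewrite !comm2E (bilinDl bv) (bilinDr bv).
by rewrite (bilinNl bv) (bilinNr bv) -sub_sum_cross.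
Qed.

Lemma lie_sym2_bracket y S w :
  lie y (sym2_bracket S w) =
  sym2_bracket (sym2_actn y S) w + sym2_bracket S (sym2_actp y w).
Proof.
have fb := instr_form_bilin.
apply: instr_form_inj => x; rewrite (bilinDr fb) -instr_form_invariant.
rewrite !sym2_bracketP sym2_actn_lie (bilinDl sfb) (bilinNl sfb).
by congr (_ + _); rewrite sym2_act_skew opprK.
Qed.

Hypothesis ch2 : 2%N \notin [pchar F].

Fact sym2_gjp_axioms : is_gjp sym2_tneg sym2_tpos.
Proof.
apply: (action_gjp sym2_actn_bilin sym2_actp_bilin sym2_bracket_bilin).
- exact: sym2_actn_lie.
- exact: sym2_actp_lie.
- exact: lie_sym2_bracket.
Qed.

Fact sym2_form_axioms : is_gjp_form sym2_tneg sym2_tpos sf.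
Proof.
apply: (action_gjp_form sfb (sym2_form_nondeg ch2 bb nb) sym2_act_skew _
          sym2_bracketP).
exact: instr_form_sym.
Qed.

Definition sym2_gjp : metricGJP := MetricGJP sym2_gjp_axioms sym2_form_axioms.
End InnerStructure.
End JordanPairs.

Coercion gjp_of_metric : metricGJP >-> gjPair.

Section MatrixPairs.
Variable F : fieldType.

Section TypeI.
Variables p q : nat.
Notation M := 'M[F]_(p, q).

Definition rect_triple (x y z : M) : M := x *m y^T *m z + z *m y^T *m x.
Definition rect_form (x y : M) : F := \tr (x *m y^T).

Let addE m n (A B : 'M[F]_(m, n)) i j : (A + B) i j = A i j + B i j.
Proof. by rewrite mxE. Qed.
Let oppE m n (A : 'M[F]_(m, n)) i j : (- A) i j = - A i j.
Proof. by rewrite mxE. Qed.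
Let scaleE m n k (A : 'M[F]_(m, n)) i j : (k *: A) i j = k * A i j.
Proof. by rewrite mxE. Qed.

Fact rect_trilin : trilin rect_triple.
Proof.
split=> [y z|x z|x y] k u v; apply/matrixP => i j;
  rewrite /rect_triple ?linearP /= !(mulmxDl, mulmxDr) -!(scalemxAl, scalemxAr);
  by rewrite !(addE, scaleE) mulrDr addrACA.
Qed.

Fact rect_identity : gjp_identity rect_triple rect_triple.
Proof.
move=> x y z w u; apply/matrixP => i j; rewrite /rect_triple.
rewrite !linearD /= !trmx_mul !trmxK !(mulmxDl, mulmxDr, mulmxA).
by rewrite !(addE, oppE); ring.
Qed.

Fact rect_gjp_axioms : is_gjp rect_triple rect_triple.
Proof. by split; [exact: rect_trilin.. | |]; exact: rect_identity. Qed.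

Lemma rect_formE x y : rect_form x y = \sum_i \sum_j x i j * y i j.
Proof.
by apply: eq_bigr => i _; rewrite mxE; apply: eq_bigr => j _; rewrite mxE.
Qed.

Lemma rect_formC x y : rect_form x y = rect_form y x.
Proof.
rewrite !rect_formE; apply: eq_bigr => i _; apply: eq_bigr => j _.
exact: mulrC.
Qed.

Lemma rect_form_delta x i j : rect_form x (delta_mx i j) = x i j.
Proof.
rewrite rect_formE (bigD1 i) //= (bigD1 j) //= mxE !eqxx mulr1.
rewrite big1 => [|l /negPf nl]; last by rewrite mxE nl andbF mulr0.
rewrite addr0 big1 ?addr0 // => k /negPf nk; apply: big1 => l _.
by rewrite mxE nk mulr0.
Qed.

Fact rect_form_axioms : is_gjp_form rect_triple rect_triple rect_form.
Proof.
split.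
- split=> u k x y; rewrite /rect_form.
    by rewrite mulmxDl -scalemxAl mxtraceD mxtraceZ.
  by rewrite linearP /= mulmxDr -scalemxAr mxtraceD mxtraceZ.
- split=> [x x0|y y0]; apply/matrixP => i j; rewrite mxE.
    by rewrite -rect_form_delta.
  by rewrite -rect_form_delta rect_formC.
- move=> x y z w; rewrite /rect_form /rect_triple.
  rewrite !linearD /= !trmx_mul !trmxK !(mulmxDl, mulmxDr, mulmxA) !mxtraceD.
  congr (_ + _).
  by rewrite -[x *m _ *m z *m _]mulmxA mxtrace_mulC mulmxA.
- move=> x y z w; rewrite /rect_form /rect_triple.
  rewrite !mulmxDl !mxtraceD.
  congr (_ + _).
    by rewrite -[x *m _ *m z *m _]mulmxA mxtrace_mulC mulmxA.
  by rewrite -[z *m y^T *m x *m w^T]mulmxA mxtrace_mulC mulmxA.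
- move=> x y z w; rewrite /rect_form /rect_triple.
  rewrite !linearD /= !trmx_mul !trmxK ?mulmxDr !mulmxA ?mxtraceD.
  congr (_ + _).
    by rewrite -[x *m _ *m z *m _]mulmxA mxtrace_mulC mulmxA.
  by rewrite -[x *m _ *m z *m _]mulmxA mxtrace_mulC mulmxA.
Qed.

Definition pairI : metricGJP F := MetricGJP rect_gjp_axioms rect_form_axioms.
End TypeI.

Section TypeIII.
Variable n : nat.

Definition symmx : {vspace 'M[F]_n} := lker (linfun (fun A => A^T - A)).

Lemma mem_symmx A : (A \in symmx) = (A^T == A).
Proof.
have lT : linear (fun A : 'M[F]_n => A^T - A).
  by move=> k B C; rewrite linearP /= scalerBr opprD addrACA.
by rewrite memv_ker (lfunE (mkLin lT)) subr_eq0.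
Qed.

(* H_n(F) *)
Definition symT := subvs_of symmx.

Lemma symTP (x : symT) : (vsval x)^T = vsval x.
Proof. by apply/eqP; rewrite -mem_symmx subvsP. Qed.

Fact sym_gen_subproof (i j : 'I_n) :
  delta_mx i j + delta_mx j i \in symmx.
Proof. by rewrite mem_symmx linearD /= !trmx_delta addrC. Qed.

(* E_ij + E_ji *)
Definition sym_gen (i j : 'I_n) : symT := Subvs (sym_gen_subproof i j).

Fact sym_triple_subproof (x y z : symT) :
  rect_triple (vsval x) (vsval y) (vsval z) \in symmx.
Proof.
by rewrite mem_symmx /rect_triple linearD /= !trmx_mul !trmxK !symTP !mulmxA addrC.
Qed.

Definition sym_triple (x y z : symT) : symT := Subvs (sym_triple_subproof x y z).

Definition sym_form (x y : symT) : F :=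
  \sum_i vsval x i i * vsval y i i +
  2 * \sum_(i < n) \sum_(j < n | (i < j)%N) vsval x i j * vsval y i j.

Fact sym_gjp_axioms : is_gjp sym_triple sym_triple.
Proof.
have [l1 l2 l3] := rect_trilin n n.
have idS : gjp_identity sym_triple sym_triple.
  by move=> x y z w u; apply: val_inj; apply: rect_identity.
have lS : trilin sym_triple.
  split=> [y z|x z|x y] k u v; apply: val_inj.
  - exact: (l1 (vsval y) (vsval z) k (vsval u) (vsval v)).
  - exact: (l2 (vsval x) (vsval z) k (vsval u) (vsval v)).
  - exact: (l3 (vsval x) (vsval y) k (vsval u) (vsval v)).
by split.
Qed.

Lemma sym_formE x y : sym_form x y = rect_form (vsval x) (vsval y).
Proof.
rewrite rect_formE /sym_form mulr_natl mulr2n.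
have -> : \sum_i \sum_j vsval x i j * vsval y i j =
    \sum_i (vsval x i i * vsval y i i +
      (\sum_(j < n | (i < j)%N) vsval x i j * vsval y i j +
       \sum_(j < n | (j < i)%N) vsval x i j * vsval y i j)).
  apply: eq_bigr => i _; rewrite (bigD1 i) //= (bigID (fun j : 'I_n => (i < j)%N)) /=.
  congr (_ + (_ + _)); apply: eq_bigl => j; rewrite -val_eqE /=; by case: ltngtP.
rewrite !big_split /=; congr (_ + (_ + _)).
rewrite (exchange_big_dep xpredT) //=; apply: eq_bigr => i _; apply: eq_bigr => j _.
by rewrite -{1}(symTP x) -{1}(symTP y) !mxE.
Qed.

Fact sym_form_axioms :
  2%N \notin [pchar F] -> is_gjp_form sym_triple sym_triple sym_form.
Proof.
move=> ch2; have [bb _ a1 a2 a3] := rect_form_axioms n n.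
have n2 : 2%:R != 0 :> F by apply: contra ch2 => e2; rewrite inE e2.
have H x : (forall y, sym_form x y = 0) -> x = 0.
  move=> x0; apply: val_inj; apply/matrixP => i j; rewrite [RHS]mxE.
  apply/eqP; have := x0 (sym_gen i j); rewrite sym_formE /= (bilinDr bb).
  rewrite !rect_form_delta -[in vsval x j i](symTP x) mxE -mulr2n -mulr_natl.
  by move/eqP; rewrite mulf_eq0 (negPf n2).
split.
- by split=> u k x y; rewrite !sym_formE /= ?(bilinPl bb) ?(bilinPr bb).
- by split=> // y y0; apply: H => x; rewrite sym_formE rect_formC -sym_formE.
- by move=> x y z w; rewrite !sym_formE a1.
- by move=> x y z w; rewrite !sym_formE a2.
- by move=> x y z w; rewrite !sym_formE a3.
Qed.

Definition pairIII (ch2 : 2%N \notin [pchar F]) : metricGJP F :=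
  MetricGJP sym_gjp_axioms (sym_form_axioms ch2).
End TypeIII.

Lemma half_neq0 : 2%N \notin [pchar F] -> 2^-1 != 0 :> F.
Proof. by move=> ch2; rewrite invr_eq0; apply: contra ch2 => e2; rewrite inE e2. Qed.

(* The prescription E_ij + E_ji |-> e_i \/ e_j for i <= j; e_i is the         *)
(* canonical basis of the space of rows.                                      *)
Definition sym_to_sym2_spec (n : nat) (f : 'Hom(symT n, sym2T 'rV[F]_n)) : Prop :=
  forall i j : 'I_n, (i <= j)%N ->
    f (sym_gen i j) = vee (delta_mx 0 i) (delta_mx 0 j).
End MatrixPairs.

(* Main.v *)
(* The inverse of f is the linear map h : a \/ b |-> a^T b + b^T a. In the     *)
(* pair of rows, nu(f, v) p = <f, v> p + <p, v> f, which determines            *)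
(* [S, w] p = 2 <S, w> p + p h(w) h(S) for S and w in the symmetric squares   *)
(* (both sides are bilinear, so S = a \/ b and w = c \/ d suffice). Extended   *)
(* to the symmetric square, h([S, w] T) = 4 <S, w> h(T) + {h(S), h(w), h(T)}; *)
(* the first term is what the shift by -4 removes.                            *)
Require Import Defs.
From mathcomp Require Import all_boot all_order all_algebra.
From mathcomp Require Import ring.

Import GRing.Theory.
Local Open Scope ring_scope.

(** The work is done on the inverse map [sym2_to_sym]: the universal property of the symmetric
    square defines it, and multilinear identities then need checking only on elements [vee a b]. By
    [sym2_bracket_negE] and [sym2_bracket_posE], [S, w] acts on rows as a scalar plus right
    multiplication by a product of the two symmetric matrices. Extended as a derivation to a^T b +
    b^T a, such an operator multiplies from both sides, which gives the triple product of symmetric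
    matrices ([sym2_to_sym_der]) plus a scalar term that the shift cancels. The comparison of forms
    [sym2_form_rectE] also yields injectivity, so no dimension count is needed. *)

(** * Rows, symmetrized outer products and the comparison of forms *)

Section RowVectors.
Variables (F : fieldType) (n : nat).
Implicit Types (a b c d p q : 'rV[F]_n) (A : 'M[F]_n).

Lemma row_mul_tr a b : a *m b^T = (rect_form a b)%:M.
Proof. by rewrite [LHS]mx11_scalar /rect_form trace_mx11. Qed.

Lemma row_tripleE a b c :
  rect_triple a b c = rect_form a b *: c + rect_form c b *: a.
Proof. by rewrite /rect_triple !row_mul_tr !mul_scalar_mx. Qed.

Fact vee_sym_subproof a b : a^T *m b + b^T *m a \in symmx F n.
Proof. by rewrite mem_symmx linearD /= !trmx_mul !trmxK addrC. Qed.

Definition vee_sym a b : symT F n := Subvs (vee_sym_subproof a b).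

Lemma vee_symC a b : vee_sym a b = vee_sym b a.
Proof. by apply: val_inj; rewrite /= addrC. Qed.

Lemma vee_sym_bilin : bilin vee_sym.
Proof.
split=> c k a b; apply: val_inj; rewrite /= (linearP trmx) mulmxDl mulmxDr;
  by rewrite -scalemxAl -scalemxAr scalerDr addrACA.
Qed.

Lemma vee_sym_delta i j : vee_sym (delta_mx 0 i) (delta_mx 0 j) = sym_gen F i j.
Proof. by apply: val_inj; rewrite /= !trmx_delta !mul_delta_mx. Qed.

Lemma mul_row_vee_sym p a b :
  p *m vsval (vee_sym a b) = rect_form p a *: b + rect_form p b *: a.
Proof. by rewrite /= mulmxDr !mulmxA !row_mul_tr !mul_scalar_mx. Qed.

Definition sym2_to_sym : sym2T 'rV[F]_n -> symT F n := sym2_lift vee_sym.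

Lemma sym2_to_sym_linear : linear sym2_to_sym.
Proof. exact: sym2_lift_linear. Qed.

Lemma sym2_to_sym_vee a b : sym2_to_sym (vee a b) = vee_sym a b.
Proof. exact: sym2_lift_vee vee_sym_bilin vee_symC. Qed.

Lemma sym2_mx_linear : linear (fun S => vsval (sym2_to_sym S)).
Proof. by move=> k S T; rewrite sym2_to_sym_linear linearP. Qed.

(** The trace of (a^T b + b^T a)(c^T d + d^T c) contains each of <a, c><b, d> and <a, d><b, c>
    twice, whence the factor 1/2. *)
Lemma sym2_form_rectE S T :
  2%N \notin [pchar F] ->
  sym2_form (@rect_form F 1 n) S T =
  2^-1 * sym_form (sym2_to_sym S) (sym2_to_sym T).
Proof.
move=> ch2; have n2 : 2%:R != 0 :> F by apply: contra ch2 => e2; rewrite inE e2.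
have [bb _ _ _ _] := rect_form_axioms F 1 n.
have [bbn _ _ _ _] := rect_form_axioms F n n.
have lm := sym2_mx_linear.
apply: (@sym2_ext2 _ _ _ F^o (sym2_form (@rect_form F 1 n))
  (fun S T => 2^-1 * sym_form (sym2_to_sym S) (sym2_to_sym T))).
- exact: sym2_form_bilin.
- split=> W k U V; rewrite !sym_formE lm ?(bilinPl bbn) ?(bilinPr bbn);
    rewrite /GRing.scale /=; ring.
move=> a b c d; rewrite (sym2_form_vee bb) sym_formE !sym2_to_sym_vee.
(* Cyclicity of the trace leaves only rows times a symmetric matrix, which [mul_row_vee_sym]
   evaluates. *)
have formE p A q : rect_form (q^T *m p) A = \tr (p *m A^T *m q^T).
  by rewrite /rect_form -mulmxA mxtrace_mulC.
rewrite [vsval (vee_sym a b)](erefl : _ = a^T *m b + b^T *m a) (bilinDl bbn).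
rewrite !formE !symTP !mul_row_vee_sym.
rewrite !mulmxDl -!scalemxAl !row_mul_tr !mxtraceD !mxtraceZ !mxtrace_scalar.
rewrite ![rect_form _ a]rect_formC ![rect_form _ b]rect_formC.
by field.
Qed.
End RowVectors.

Arguments sym2_to_sym {F n}.

(** * The bracket [S, w] and the triple products *)

Section Bracket.
Variables (F : fieldType) (n : nat).
Notation V := (pairI F 1 n).
Notation sf := (sym2_form (@rect_form F 1 n)).
Notation mx S := (vsval (sym2_to_sym S)).
Hypothesis ch2 : 2%N \notin [pchar F].

(** Expanding <x . (a \/ b), c \/ d> gives four terms, each a scalar times some b(x, nu(f, v)) = <x
    . f, v>; nondegeneracy of b then identifies the bracket. *)
Lemma sym2_bracket_vee (a b c d : 'rV[F]_n) :
  @sym2_bracket F V (vee a b) (vee c d) =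
  rect_form b d *: @nuL F V a c + rect_form b c *: @nuL F V a d +
  rect_form a c *: @nuL F V b d + rect_form a d *: @nuL F V b c.
Proof.
have [bb _ _ _ _] := mg_form_axioms V.
have fb := @instr_form_bilin F V.
have bs := sym2_form_bilin (@mg_form F V).
apply: instr_form_inj => x; rewrite sym2_bracketP /sym2_actn sym2_der_vee; last first.
  by move=> k u v; rewrite linearP.
rewrite !(bilinDr fb) !(bilinZr fb) !instr_form_nu (bilinDl bs) !(sym2_form_vee bb).
rewrite /GRing.scale /=; ring.
Qed.

Lemma sym2_bracket_negE S w (p : 'rV[F]_n) :
  (vsval (@sym2_bracket F V S w)).1 p = (2 * sf S w) *: p + p *m mx w *m mx S.
Proof.
have bs := sym2_form_bilin (@rect_form F 1 n).
have [bb _ _ _ _] := rect_form_axioms F 1 n.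
have lm := @sym2_mx_linear F n.
have bbr := @sym2_bracket_bilin F V.
apply: (@sym2_ext2 _ _ _ _
  (fun S w => (vsval (@sym2_bracket F V S w)).1 p)
  (fun S w => (2 * sf S w) *: p + p *m mx w *m mx S)).
- split=> [W|W] k U T.
    by rewrite (bilinPl bbr) linearP EE_1.
  by rewrite (bilinPr bbr) linearP EE_1.
- split=> [W|W] k U T; rewrite ?(bilinPl bs) ?(bilinPr bs) lm;
    rewrite !(mulmxDr, mulmxDl) -?scalemxAr -?scalemxAl mulrDr scalerDl;
    by rewrite scalerDr scalerA mulrCA addrACA.
move=> a b c d; rewrite sym2_bracket_vee !sym2_to_sym_vee (sym2_form_vee bb).
rewrite [p *m _]mul_row_vee_sym mulmxDl -!scalemxAl !mul_row_vee_sym.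
rewrite !linearD !linearZ /= !add_lfunE !scale_lfunE.
have nuE f v : linfun (@rect_triple F 1 n f v) p = rect_triple f v p :=
  @nu1E F V f v p.
rewrite !nuE !row_tripleE.
rewrite ![rect_form _ a]rect_formC ![rect_form _ b]rect_formC.
by apply/rowP => i; rewrite !mxE; ring.
Qed.

(** Mirror image of [sym2_bracket_negE]: S and w trade places, and the sign is that of the second
    component of [nu]. *)
Lemma sym2_bracket_posE S w (p : 'rV[F]_n) :
  (vsval (@sym2_bracket F V S w)).2 p =
  - ((2 * sf S w) *: p + p *m mx S *m mx w).
Proof.
have bs := sym2_form_bilin (@rect_form F 1 n).
have [bb _ _ _ _] := rect_form_axioms F 1 n.
have lm := @sym2_mx_linear F n.
have bbr := @sym2_bracket_bilin F V.
apply: (@sym2_ext2 _ _ _ _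
  (fun S w => (vsval (@sym2_bracket F V S w)).2 p)
  (fun S w => - ((2 * sf S w) *: p + p *m mx S *m mx w))).
- split=> [W|W] k U T.
    by rewrite (bilinPl bbr) linearP EE_2.
  by rewrite (bilinPr bbr) linearP EE_2.
- split=> [W|W] k U T; rewrite ?(bilinPl bs) ?(bilinPr bs) lm;
    rewrite !(mulmxDr, mulmxDl) -?scalemxAr -?scalemxAl mulrDr scalerDl;
    by rewrite scalerN -opprD scalerDr scalerA mulrCA addrACA.
move=> a b c d; rewrite sym2_bracket_vee !sym2_to_sym_vee (sym2_form_vee bb).
rewrite [p *m _]mul_row_vee_sym mulmxDl -!scalemxAl !mul_row_vee_sym.
rewrite !linearD !linearZ /= !add_lfunE !scale_lfunE.
have nuE f v : (- linfun (@rect_triple F 1 n v f)) p = - rect_triple v f p :=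
  @nu2E F V f v p.
rewrite !nuE !row_tripleE.
rewrite ![rect_form _ c]rect_formC ![rect_form _ d]rect_formC.
by apply/rowP => i; rewrite !mxE; ring.
Qed.

(** For Z = a^T b + b^T a, applying g to each factor in turn gives 2kZ + Zyx + xyZ: transposition
    turns the right factor yx into a left factor xy. *)
Lemma sym2_to_sym_der (g : 'rV[F]_n -> 'rV[F]_n) k (x y : symT F n) T :
  linear g -> (forall p, g p = k *: p + p *m vsval y *m vsval x) ->
  sym2_to_sym (sym2_der g T) =
  (2 * k) *: sym2_to_sym T + sym_triple x y (sym2_to_sym T).
Proof.
move=> lg gE.
have lt := @sym2_to_sym_linear F n.
have [_ _ t3] := rect_trilin F n n.
apply: (@sym2_ext _ _ _ (fun T => sym2_to_sym (sym2_der g T))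
  (fun T => (2 * k) *: sym2_to_sym T + sym_triple x y (sym2_to_sym T))).
- by move=> c S U; rewrite (sym2_der_linear g) lt.
- move=> c S U; apply: val_inj; rewrite /= lt !linearD !linearZ /= t3.
  by rewrite !scalerDr !scalerA mulrC addrACA.
move=> p q; rewrite sym2_der_vee // (linD lt) !sym2_to_sym_vee.
apply: val_inj; rewrite /= /rect_triple /= !gE !symTP.
rewrite !linearD !linearZ /= !trmx_mul !symTP.
rewrite !(mulmxDl, mulmxDr) -?scalemxAl -?scalemxAr !mulmxA.
have addE (A B : 'M[F]_n) i j : (A + B) i j = A i j + B i j by rewrite mxE.
have scaleE c (A : 'M[F]_n) i j : (c *: A) i j = c * A i j by rewrite mxE.
by apply/matrixP => i j; rewrite !(addE, scaleE); ring.
Qed.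

Notation W := (tensor_shift (-4) (sym2_gjp V ch2)).

Lemma sym2_to_sym_tneg (S w T : sym2T 'rV[F]_n) :
  sym2_to_sym (mg_tneg (m := W) S w T) =
  sym_triple (sym2_to_sym S) (sym2_to_sym w) (sym2_to_sym T).
Proof.
have lt := @sym2_to_sym_linear F n.
rewrite /= /shift_tneg (linD lt) (linZ lt) /= /sym2_tneg /sym2_actn.
rewrite (@sym2_to_sym_der _ (2 * sf S w) (sym2_to_sym S) (sym2_to_sym w)).
(* The scalar terms cancel: 2 * (2 <S, w>) - 4 <S, w> = 0. *)
- by rewrite addrAC -scalerDl (_ : _ + _ = 0 :> F) ?scale0r ?add0r //; ring.
- by move=> k u v; rewrite linearP.
- exact: sym2_bracket_negE.
Qed.

Lemma sym2_to_sym_tpos (w S u : sym2T 'rV[F]_n) :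
  sym2_to_sym (mg_tpos (m := W) w S u) =
  sym_triple (sym2_to_sym w) (sym2_to_sym S) (sym2_to_sym u).
Proof.
have lt := @sym2_to_sym_linear F n.
rewrite /= /shift_tpos (linD lt) (linZ lt) /= /sym2_tpos /sym2_actp.
set g := fun_of_lfun _.
(* The sign in the positive product is absorbed into the operator, cancelling that of
   [sym2_bracket_posE]. *)
have -> : - sym2_der g u = sym2_der (fun p => - g p) u.
  rewrite /sym2_der /sym2_lift -sumrN; apply: eq_bigr => ij _.
  have bv := @vee_bilin F 'rV[F]_n.
  by rewrite (bilinNl bv) (bilinNr bv) -opprD scalerN.
rewrite (@sym2_to_sym_der _ (2 * sf S w) (sym2_to_sym w) (sym2_to_sym S)).
- by rewrite addrAC -scalerDl (_ : _ + _ = 0 :> F) ?scale0r ?add0r //; ring.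
- by move=> k a b; rewrite /g linearP opprD scalerN.
- by move=> p; rewrite /g sym2_bracket_posE opprK.
Qed.
End Bracket.

(** * Bijectivity and the prescription on generators *)

Section Isomorphism.
Variables (F : fieldType) (n : nat).
Hypothesis ch2 : 2%N \notin [pchar F].

(** The double sum is x + x^T = 2x. *)
Lemma sym_sum_gen (x : symT F n) :
  x = 2^-1 *: \sum_i \sum_j vsval x i j *: sym_gen F i j.
Proof.
have n2 : 2%:R != 0 :> F by apply: contra ch2 => e2; rewrite inE e2.
apply: (scalerI n2); rewrite scalerA divff // scale1r scaler_nat mulr2n.
apply: val_inj; rewrite /= linear_sum /=.
under [RHS]eq_bigr => i _.
  rewrite linear_sum /=; under eq_bigr do rewrite scalerDr.
  rewrite big_split /=; over.
rewrite big_split /= -matrix_sum_delta; congr (_ + _).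
rewrite exchange_big /= [LHS]matrix_sum_delta.
by do 2![apply: eq_bigr => ? _]; rewrite -{1}(symTP x) mxE.
Qed.

Lemma sym_genC i j : sym_gen F i j = sym_gen F j i :> symT F n.
Proof. by apply: val_inj; rewrite /= addrC. Qed.

(** Summing over all (i, j) and halving treats diagonal and off-diagonal generators alike. *)
Definition sym_to_sym2 (x : symT F n) : sym2T 'rV[F]_n :=
  2^-1 *: \sum_i \sum_j vsval x i j *: vee (delta_mx 0 i) (delta_mx 0 j).

Lemma sym_to_sym2_linear : linear sym_to_sym2.
Proof.
move=> k x y; rewrite /sym_to_sym2 scalerA mulrC -scalerA -scalerDr.
congr (_ *: _); rewrite scaler_sumr -big_split; apply: eq_bigr => i _ /=.
rewrite scaler_sumr -big_split; apply: eq_bigr => j _ /=.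
by rewrite !mxE scalerDl scalerA.
Qed.

Lemma sym2_to_symK : cancel sym_to_sym2 (@sym2_to_sym F n).
Proof.
have lt := @sym2_to_sym_linear F n.
move=> x; rewrite [RHS]sym_sum_gen (linZ lt) (lin_sum lt); congr (_ *: _).
apply: eq_bigr => i _; rewrite (lin_sum lt); apply: eq_bigr => j _.
by rewrite (linZ lt) sym2_to_sym_vee vee_sym_delta.
Qed.

(** An element of the kernel is orthogonal to everything by [sym2_form_rectE], hence zero because
    the form on the symmetric square is nondegenerate. *)
Lemma sym2_to_sym_inj : injective (@sym2_to_sym F n).
Proof.
have lt := @sym2_to_sym_linear F n.
have [bb nb _ _ _] := rect_form_axioms F 1 n.
have [nl _] := sym2_form_nondeg ch2 bb nb.
move=> S T e; apply/eqP; rewrite -subr_eq0; apply/eqP/nl => w.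
rewrite sym2_form_rectE // (linD lt) (linN lt) e subrr sym_formE.
have [bbn _ _ _ _] := rect_form_axioms F n n.
by rewrite linear0 (bilin0l bbn) mulr0.
Qed.

Lemma sym_to_sym2K : cancel (@sym2_to_sym F n) sym_to_sym2.
Proof. exact: inj_can_sym sym2_to_symK sym2_to_sym_inj. Qed.

Lemma sym_to_sym2_gen i j :
  sym_to_sym2 (sym_gen F i j) = vee (delta_mx 0 i) (delta_mx 0 j).
Proof. by rewrite -vee_sym_delta -sym2_to_sym_vee sym_to_sym2K. Qed.

Lemma sym_to_sym2_specP (f : 'Hom(symT F n, sym2T 'rV[F]_n)) :
  sym_to_sym2_spec f <-> f =1 sym_to_sym2.
Proof.
split=> [fE x|fE i j _]; last by rewrite fE sym_to_sym2_gen.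
rewrite {1}[x]sym_sum_gen linearZ linear_sum; congr (_ *: _).
apply: eq_bigr => i _; rewrite linear_sum; apply: eq_bigr => j _.
(* The prescription covers only i <= j; symmetry of both sides settles i > j. *)
rewrite linearZ; congr (_ *: _); case: (leqP i j) => [|/ltnW] /fE //.
by rewrite sym_genC veeC.
Qed.

Lemma sym_to_sym2_metric_iso :
  is_metric_iso (V := rescale (half_neq0 ch2) (pairIII n ch2))
    (W := tensor_shift (-4) (sym2_gjp (pairI F 1 n) ch2))
    sym_to_sym2 sym_to_sym2.
Proof.
have bij : bijective sym_to_sym2 := Bijective sym2_to_symK sym_to_sym2K.
have lin := sym_to_sym2_linear.
split; first split=> // x y z.
- apply: esym; apply: (canRL sym_to_sym2K).
  by rewrite sym2_to_sym_tneg !sym2_to_symK.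
- apply: esym; apply: (canRL sym_to_sym2K).
  by rewrite sym2_to_sym_tpos !sym2_to_symK.
by move=> x y; rewrite /= sym2_form_rectE // !sym2_to_symK.
Qed.
End Isomorphism.

Theorem mainTheorem4 (F : fieldType) (ch2 : 2%N \notin [pchar F])
    (n : nat) (hn : (1 <= n)%N) :
  [/\ exists! f : 'Hom(symT F n, sym2T 'rV[F]_n), sym_to_sym2_spec f,
      forall fn fp : 'Hom(symT F n, sym2T 'rV[F]_n),
        sym_to_sym2_spec fn -> sym_to_sym2_spec fp ->
        is_gjp_iso (V := pairIII n ch2)
          (W := tensor_shift (-4) (sym2_gjp (pairI F 1 n) ch2)) fn fp /\
        (forall x y : symT F n,
          mg_form (m := sym2_gjp (pairI F 1 n) ch2) (fn x) (fp y) =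
          2^-1 * sym_form x y) &
      metric_isomorphic
        (rescale (half_neq0 ch2) (pairIII n ch2))
        (tensor_shift (-4) (sym2_gjp (pairI F 1 n) ch2))].
Proof.
have [iso form] := @sym_to_sym2_metric_iso F n ch2.
split; last by exists (@sym_to_sym2 F n), (@sym_to_sym2 F n).
  have fE := lfunE (mkLin (@sym_to_sym2_linear F n)).
  exists (linfun (@sym_to_sym2 F n)); split; first exact/(sym_to_sym2_specP F n ch2).
  by move=> f /(sym_to_sym2_specP F n ch2) gE; apply/lfunP => x; rewrite fE gE.
move=> fn fp /(sym_to_sym2_specP F n ch2) fnE /(sym_to_sym2_specP F n ch2) fpE.
(* Rescaling changes only the form and the shift only the products, so [iso] and [form] apply by
   conversion. *)
have [[l _] [b _] tn tp] := iso.
split; last by move=> x y; rewrite fnE fpE; apply: form.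
split.
- by split=> k x y; rewrite linearP.
- by split; [apply: eq_bij b _ _ | apply: eq_bij b _ _] => x; rewrite ?fnE ?fpE.
- by move=> x y z; rewrite !fnE fpE; apply: tn.
- by move=> x y z; rewrite !fpE fnE; apply: tp.
Qed.
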